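(* Let $I\subseteq\mathbb{R}$ be an interval and let $(\mathscr{M},\mathscr{N})$ be an Ingham--Jessen pair of symmetric and repetition invariant means on $I$. Let $k,m,n\in\mathbb{N}$ and let $F_1,\dots,F_k,\,G_1,\dots,G_m\colon\mathbb{N}_n\to\mathbb{N}_0$ be functions, none of which is identically zero. If the sequences $(\mathscr{D}_{F_i})_{i=1}^k$ and $(\mathscr{D}_{G_j})_{j=1}^m$ are $\mathbb{R}$-conjugated, then $$\mathscr{N}\big(\mathscr{M}_{F_1}(x),\dots,\mathscr{M}_{F_k}(x)\big)\le \mathscr{M}\big(\mathscr{N}_{G_1}(x),\dots,\mathscr{N}_{G_m}(x)\big)\qquad\text{for every } x\in I^n.$$
   Context: Notation: $\mathbb{N}=\{1,2,\dots\}$, $\mathbb{N}_0=\mathbb{N}\cup\{0\}$, and $\mathbb{N}_n=\{1,\dots,n\}$. A mean on an interval $I$ is a function $\mathscr{M}\colon\bigcup_{n=1}^\infty I^n\to I$ such that $\min(x_1,\dots,x_n)\le\mathscr{M}(x_1,\dots,x_n)\le\max(x_1,\dots,x_n)$ for all $n\in\mathbb{N}$ and $(x_1,\dots,x_n)\in I^n$. It is symmetric if, for every $n\in\mathbb{N}$, its restriction to $I^n$ is invariant under permutations of the variables. It is repetition invariant if, for all $n,m\in\mathbb{N}$ and $(x_1,\dots,x_n)\in I^n$, $$\mathscr{M}(\underbrace{x_1,\dots,x_1}_{m\text{ times}},\dots,\underbrace{x_n,\dots,x_n}_{m\text{ times}})=\mathscr{M}(x_1,\dots,x_n).$$ A pair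 $(\mathscr{M},\mathscr{N})$ of means on $I$ is an Ingham--Jessen pair if, for all $n,m\in\mathbb{N}$ and all $x_{ij}\in I$ ($i\in\mathbb{N}_n$, $j\in\mathbb{N}_m$), $$\mathscr{N}\big(\mathscr{M}(x_{11},\dots,x_{1m}),\dots,\mathscr{M}(x_{n1},\dots,x_{nm})\big)\le\mathscr{M}\big(\mathscr{N}(x_{11},\dots,x_{n1}),\dots,\mathscr{N}(x_{1m},\dots,x_{nm})\big).$$ For a mean $\mathscr{M}$ on $I$ and a not identically zero function $F\colon\mathbb{N}_n\to\mathbb{N}_0$, the function $\mathscr{M}_F\colon I^n\to I$ is defined by $$\mathscr{M}_F(x_1,\dots,x_n):=\mathscr{M}\big(\underbrace{x_1,\dots,x_1}_{F(1)\text{ times}},\dots,\underbrace{x_n,\dots,x_n}_{F(n)\text{ times}}\big).$$ For a not identically zero $W\colon\mathbb{N}_n\to\mathbb{N}_0$, put $$\mathscr{D}_W:=\Big(\frac{W(1)}{W(1)+\cdots+W(n)},\dots,\frac{W(n)}{W(1)+\cdots+W(n)}\Big).$$ Let $\Pi_n(\mathbb{R})$ be the set of all $(\pi_1,\dots,\pi_n)\in[0,1]^n$ with $\pi_1+\cdots+\pi_n=1$. Sequences $(P_1,\dots,P_k)\in\Pi_n(\mathbb{R})^k$ and $(Q_1,\dots,Q_m)\in\Pi_n(\mathbb{R})^m$ are called $\mathbb{R}$-conjugated if there exists a matrix $(R_{i,j})\in\Pi_n(\mathbb{R})^{k\times m}$ (that is, a $k\times m$ array of elements of $\Pi_n(\mathbb{R})$)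 such that $P_i=\frac1m\sum_{j=1}^m R_{i,j}$ for all $i\in\mathbb{N}_k$ and $Q_j=\frac1k\sum_{i=1}^k R_{i,j}$ for all $j\in\mathbb{N}_m$. *)

(* Defs.v *)
From mathcomp Require Import all_boot all_order all_algebra.
From mathcomp Require Import reals.

Set Implicit Arguments.
Unset Strict Implicit.
Unset Printing Implicit Defensive.

Import Order.TTheory GRing.Theory Num.Theory.
Local Open Scope ring_scope.

(* A function on the union of the I^n, n >= 1, is encoded as a total function
   [seq R -> R]; only its values on nonempty sequences of elements of I
   matter. *)
Definition in_dom (R : realType) (I : interval R) (s : seq R) : Prop :=
  s <> [::] /\ {in s, forall x, x \in I}.

(* That M s lies in I follows from the two bounds, since I is an interval. *)
Definition is_mean (R : realType) (I : interval R) (M : seq R -> R) : Prop :=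
  forall s : seq R, in_dom I s ->
    \big[Num.min/head 0 s]_(x <- s) x <= M s
      <= \big[Num.max/head 0 s]_(x <- s) x.

Definition symmetric_mean (R : realType) (I : interval R) (M : seq R -> R)
    : Prop :=
  forall s t : seq R, in_dom I s -> perm_eq s t -> M s = M t.

Definition repetition_invariant (R : realType) (I : interval R)
    (M : seq R -> R) : Prop :=
  forall (m : nat) (s : seq R), (0 < m)%N -> in_dom I s ->
    M (flatten [seq nseq m x | x <- s]) = M s.

Definition Ingham_Jessen (R : realType) (I : interval R) (M N : seq R -> R)
    : Prop :=
  forall (n m : nat) (x : 'I_n -> 'I_m -> R),
    (0 < n)%N -> (0 < m)%N -> (forall i j, x i j \in I) ->
    N [seq M [seq x i j | j : 'I_m] | i : 'I_n]
      <= M [seq N [seq x i j | i : 'I_n] | j : 'I_m].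

Definition mean_rep (R : realType) (M : seq R -> R) (n : nat)
    (F : 'I_n -> nat) (x : 'I_n -> R) : R :=
  M (flatten [seq nseq (F i) (x i) | i : 'I_n]).

Definition distr (R : realType) (n : nat) (W : 'I_n -> nat) : 'rV[R]_n :=
  \row_(i < n) ((W i)%:R / (\sum_(j < n) W j)%N%:R).

Definition in_simplex (R : realType) (n : nat) (p : 'rV[R]_n) : Prop :=
  (forall i, 0 <= p 0 i <= 1) /\ \sum_(i < n) p 0 i = 1.

(* For k, m > 0 the equations force every P i and Q j into the simplex. *)
Definition conjugated (R : realType) (n k m : nat)
    (P : 'I_k -> 'rV[R]_n) (Q : 'I_m -> 'rV[R]_n) : Prop :=
  exists T : 'I_k -> 'I_m -> 'rV[R]_n,
    [/\ forall i j, in_simplex (T i j),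
        forall i, P i = m%:R^-1 *: \sum_(j < m) T i j
      & forall j, Q j = k%:R^-1 *: \sum_(i < k) T i j].

(* Main.v *)
(* The conjugation equations form a linear system with rational coefficients,
   so a conjugating array with real entries can be replaced by one with rational
   entries, of common denominator [d] say.  Then [c i j p = d * R_ij(p)] counts
   occurrences of [x p] in a list of length [d]; arranging this list in a d x d
   Latin square for each [(i, j)] yields a kd x md matrix.  By symmetry and
   repetition invariance, [M] of each row in the i-th block of rows is [M_(F_i)],
   and [N] of each column in the j-th block of columns is [N_(G_j)], so the
   Ingham-Jessen inequality for this matrix is the claim. *)
Require Import Defs.
From mathcomp Require Import all_boot all_order all_algebra.
From mathcomp Require Import reals.
From mathcomp Require boolp.

Set Implicit Arguments.
Unset Strict Implicit.
Unset Printing Implicit Defensive.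

Import Order.TTheory GRing.Theory Num.Theory.
Local Open Scope ring_scope.

(** * Rational and integral solutions of linear systems *)

Lemma rat_approx (R : archiRealFieldType) (a e : R) :
  0 < e -> exists q : rat, `|a - ratr q| < e.
Proof.
move=> e_gt0.
have [|q] := @rat_in_itvoo R (a - e) (a + e).
  by rewrite ltrD2l (lt_trans _ e_gt0)// oppr_lt0.
rewrite in_itv/= -ltr_distlC distrC => qP; by exists q; rewrite distrC.
Qed.

Lemma rational_nonneg_solution (R : archiRealFieldType) (p q : nat)
    (A : 'M[rat]_(p, q)) (b : 'rV[rat]_q) (z : 'rV[R]_p) :
  (forall i, 0 <= z 0 i) -> z *m map_mx ratr A = map_mx ratr b ->
  exists y : 'rV[rat]_p, (forall i, 0 <= y 0 i) /\ y *m A = b.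
Proof.
move=> z_ge0 zA.
(* Fixing the vanishing coordinates of [z] by extra equations, it remains to
   stay close to [z] within the rational affine space of solutions. *)
pose A' := row_mx A (diag_mx (\row_i (z 0 i == 0)%:R)).
pose b' : 'rV[rat]_(q + p) := row_mx b 0.
have zA' : z *m map_mx ratr A' = map_mx ratr b'.
  rewrite !map_row_mx mul_mx_row zA; congr row_mx.
  apply/rowP=> i; rewrite map_diag_mx mul_mx_diag !mxE.
  by case: eqP => [->|_]; rewrite ?mul0r ?raddf0 ?mulr0.
(* Membership in a row space is invariant under field extension, so the real solution [z] yields a
   rational one. *)
have /submxP[y0 y0A] : (b' <= A')%MS.
  by rewrite -(map_submx (ratr : {rmorphism rat -> R})) -zA' submxMl.
pose K := kermx A'.
(* The rational matrix [K] also spans the real homogeneous solutions; only the coefficients [w] need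
   approximating. *)
have /submxP[w wK] : (z - map_mx ratr y0 <= map_mx ratr K)%MS.
  by rewrite map_kermx; apply/sub_kermxP; rewrite mulmxBl zA' y0A map_mxM subrr.
(* [B] dominates every column sum of absolute values of [K], so an error below [e / B] in each
   coefficient moves each coordinate by at most [e]. *)
pose B := 1 + \sum_i \sum_j `|ratr (K i j) : R|.
have B_ge1 : 1 <= B by rewrite lerDl !sumr_ge0// => i _; rewrite sumr_ge0.
have B_gt0 : 0 < B := lt_le_trans ltr01 B_ge1.
(* A lower bound for all positive coordinates of [z], without taking a minimum; zero coordinates
   contribute [0^-1 = 0]. *)
pose e := (1 + \sum_i (z 0 i)^-1)^-1.
have iz_ge0 : 0 <= \sum_i (z 0 i)^-1 by rewrite sumr_ge0// => i _; rewrite invr_ge0.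
have e_gt0 : 0 < e by rewrite invr_gt0 ltr_wpDr.
have e_le j : 0 < z 0 j -> e <= z 0 j.
  move=> zj; rewrite -[leRHS]invrK lef_pV2 ?posrE ?invr_gt0 ?ltr_wpDr//.
  rewrite (bigD1 j)//= addrCA lerDl addr_ge0// sumr_ge0// => i _.
  by rewrite invr_ge0.
have apx i : {r : rat | `|w 0 i - ratr r| < e / B}.
  by apply/sigW/rat_approx; rewrite divr_gt0.
pose w' : 'rV[rat]_p := \row_i sval (apx i).
pose y := y0 + w' *m K.
have yA' : y *m A' = b' by rewrite mulmxDl -mulmxA mulmx_ker mulmx0 addr0 y0A.
have [yA yD] : y *m A = b /\ y *m diag_mx (\row_i (z 0 i == 0)%:R) = 0.
  by move: yA'; rewrite mul_mx_row => /eq_row_mx.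
exists y; split=> // j.
have [zj0|zj_neq0] := eqVneq (z 0 j) 0.
  by have /rowP/(_ j) := yD; rewrite mul_mx_diag !mxE zj0 eqxx mulr1 => ->.
have zj_gt0 : 0 < z 0 j by rewrite lt_neqAle eq_sym zj_neq0 z_ge0.
rewrite -(ler0q R).
suff : `|z 0 j - ratr (y 0 j)| <= e.
  move=> /(le_trans (ler_norm _)); rewrite lerBlDr => zy.
  by rewrite -(lerD2l e) addr0 (le_trans (e_le _ zj_gt0)).
have -> : z 0 j - ratr (y 0 j) = \sum_i (w 0 i - ratr (w' 0 i)) * ratr (K i j).
  have /rowP/(_ j) := wK; rewrite !mxE rmorphD/= opprD addrA => ->.
  rewrite rmorph_sum -sumrB; apply: eq_bigr => i _.
  by rewrite [map_mx _ _ _ _]mxE rmorphM/= mulrBl.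
apply: (le_trans (ler_norm_sum _ _ _)).
apply: (@le_trans _ _ (\sum_i e / B * `|ratr (K i j) : R|)).
  apply: ler_sum => i _; rewrite normrM ler_wpM2r//.
  by rewrite [w' _ _]mxE; exact: ltW (svalP (apx i)).
rewrite -mulr_sumr mulrAC ler_pdivrMr// ler_wpM2l//; first exact: ltW.
rewrite ler_wpDl// ler_sum// => i _.
by rewrite (bigD1 j)//= lerDl sumr_ge0.
Qed.

(** A rational solution exists for the 0-1 incidence matrix of [A]; clearing its denominators makes
    it integral and scales the right-hand side by [d]. *)
Lemma integral_nonneg_solution (R : archiRealFieldType) (V E : finType)
    (A : V -> pred E) (b : E -> rat) (z : V -> R) :
  (forall v, 0 <= z v) -> (forall e, \sum_(v | A v e) z v = ratr (b e)) ->
  exists (d : nat) (c : V -> nat), (0 < d)%N /\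
    forall e, (\sum_(v | A v e) c v)%N%:R = d%:R * b e.
Proof.
move=> z_ge0 zA.
pose Am : 'M[rat]_(#|V|, #|E|) :=
  \matrix_(i, j) (A (enum_val i) (enum_val j))%:R.
have [||y [y_ge0 yA]] := @rational_nonneg_solution R _ _ Am
    (\row_j b (enum_val j)) (\row_i z (enum_val i)).
- by move=> i; rewrite mxE.
- apply/rowP=> j; rewrite !mxE -zA [RHS]big_mkcond [RHS]big_enum_val/=.
  apply: eq_bigr => i _; rewrite !mxE.
  by case: (A _ _); rewrite ?rmorph1 ?rmorph0 ?mulr1 ?mulr0.
pose q v := y 0 (enum_rank v).
have [d [c [d_gt0 cE]]] : exists (d : nat) (c : V -> nat), (0 < d)%N /\
    forall v, (c v)%:R = d%:R * q v.
  (* Each [c v] is the numerator of [q v] times all the other denominators; taking absolute values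
     is harmless since [q v] is nonnegative. *)
  exists (\prod_v `|denq (q v)|)%N.
  exists (fun v => `|numq (q v)| * \prod_(u | u != v) `|denq (q u)|)%N; split.
    by rewrite prodn_gt0// => v; rewrite absz_gt0 denq_neq0.
  move=> v /=; rewrite [in RHS](bigD1 v)//= !natrM mulrAC; congr (_ * _).
  rewrite !natr_absz ger0_norm ?numq_ge0//; first by rewrite normr_denq numqE mulrC.
  exact: y_ge0.
exists d, c; split=> // e; have /rowP/(_ (enum_rank e)) := yA.
rewrite !mxE enum_rankK => <-; rewrite natr_sum mulr_sumr [LHS]big_mkcond/=.
rewrite [LHS]big_enum_val/=; apply: eq_bigr => i _; rewrite !mxE enum_rankK.
by case: (A _ _); rewrite ?mulr1 ?mulr0// cE /q enum_valK.
Qed.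

(** * Multiplicities in finite lists *)

Lemma count_image (T : Type) (U : finType) (a : pred T) (f : U -> T) :
  count a [seq f u | u : U] = (\sum_u a (f u))%N.
Proof. by rewrite -sum1_count big_map big_enum_cond big_mkcond. Qed.

Lemma image_enum_val (T : Type) (U : finType) (u0 : U) (f : U -> T) :
  [seq f (enum_val i) | i : 'I_#|U|] = [seq f u | u : U].
Proof.
transitivity [seq f u | u <- [seq nth u0 (enum U) i | i <- iota 0 #|U|]].
  rewrite -val_enum_ord -map_comp -map_comp; apply: eq_map => i /=.
  by rewrite (enum_val_nth u0).
by rewrite -/(mkseq _ _) cardE mkseq_nth.
Qed.

Lemma count_flatten_nseq (T : finType) (c : T -> nat) (p : T) :
  count_mem p (flatten [seq nseq (c q) q | q : T]) = c p.
Proof.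
rewrite count_flatten -map_comp sumnE big_map big_enum/= (bigD1 p)//=.
rewrite count_nseq/= eqxx mul1n big1 ?addn0// => q /negPf qp.
by rewrite count_nseq/= qp.
Qed.

Lemma size_flatten_nseq (T : finType) (S : Type) (c : T -> nat) (f : T -> S) :
  size (flatten [seq nseq (c q) (f q) | q : T]) = (\sum_q c q)%N.
Proof.
rewrite size_flatten sumnE big_map big_map big_enum/=.
by apply: eq_bigr => q _; rewrite size_nseq.
Qed.

(** Reading off the list that repeats each [q] exactly [c q] times, position by position, gives
    [g]. *)
Lemma fun_with_fiber_sizes (T : finType) (c : T -> nat) (d : nat) :
  (\sum_q c q)%N = d ->
  exists g : 'I_d -> T, forall p, (\sum_a (g a == p) = c p)%N.
Proof.
move=> cd; pose t := flatten [seq nseq (c q) q | q : T].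
have t_size : size t == d by rewrite size_flatten_nseq cd.
exists (tnth (Tuple t_size)) => p.
rewrite -[RHS](count_flatten_nseq c) -(count_image (pred1 p) (tnth (Tuple t_size))).
by rewrite /image_mem map_tnth_enum.
Qed.

(** * Means as functions of relative frequencies *)

Section Mean.
Variables (R : realType) (I : interval R) (M : seq R -> R).
Hypotheses (meanM : is_mean I M) (symM : symmetric_mean I M).
Hypothesis repM : repetition_invariant I M.

Lemma mean_in s : in_dom I s -> M s \in I.
Proof.
move=> sI; have [s0 sIx] := sI; have /andP[] := meanM sI.
have hI : head 0 s \in I by case: (s) s0 sIx => // a r _; apply; exact: mem_head.
have : \big[Num.min/head 0 s]_(x <- s) x \in I.
  by rewrite big_seq; elim/big_ind: _ => // u v uI vI; rewrite /Num.min; case: ifP.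
have : \big[Num.max/head 0 s]_(x <- s) x \in I.
  by rewrite big_seq; elim/big_ind: _ => // u v uI vI; rewrite /Num.max; case: ifP.
move: (\big[_/_]_(_ <- _) _) (\big[_/_]_(_ <- _) _) => u v; case: I => l r.
rewrite !itv_boundlr => /andP[_ ur] /andP[lv _] vM Mu.
by rewrite (le_trans lv) ?bnd_simp// (le_trans _ ur) ?bnd_simp.
Qed.

Lemma in_dom_map (T : eqType) (s : seq T) (x : T -> R) :
  s <> [::] -> (forall p, x p \in I) -> in_dom I [seq x p | p <- s].
Proof. by move=> s0 xI; split=> [|_ /mapP[p _ ->]//]; case: s s0. Qed.

(** Repeating every entry of [s] [a] times and every entry of [t] [b] times produces permutations of
    one another. *)
Lemma mean_proportional (T : eqType) (x : T -> R) (a b : nat) (s t : seq T) :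
  (forall p, x p \in I) -> (0 < a)%N -> (0 < b)%N -> s <> [::] -> t <> [::] ->
  (forall p, a * count_mem p s = b * count_mem p t)%N ->
  M [seq x p | p <- s] = M [seq x p | p <- t].
Proof.
move=> xI a_gt0 b_gt0 s0 t0 st.
have rep e (r : seq T) : [seq x p | p <- flatten [seq nseq e p | p <- r]] =
    flatten [seq nseq e y | y <- [seq x p | p <- r]].
  by rewrite map_flatten -!map_comp; congr flatten; apply: eq_map => p /=;
     rewrite map_nseq.
have count_rep e (r : seq T) p :
    (count_mem p (flatten [seq nseq e q | q <- r]) = e * count_mem p r)%N.
  rewrite count_flatten -map_comp; elim: r => [|q r IHr]/=; first by rewrite muln0.
  by rewrite IHr count_nseq mulnDr mulnC.
rewrite -(repM a_gt0 (in_dom_map s0 xI)) -(repM b_gt0 (in_dom_map t0 xI)) -!rep.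
apply: symM; last first.
  by apply/perm_map/allP => p _; rewrite /= !count_rep st.
apply: in_dom_map => // /(congr1 (fun r => has predT r)).
by case: s s0 {st} => // q s _; case: a a_gt0.
Qed.

(** The last hypothesis says that [p] has relative frequency [F p / \sum_p F p] among the values of
    [g], cross-multiplied to stay in [nat]. *)
Lemma mean_image (U : finType) (u0 : U) (n : nat) (x : 'I_n -> R)
    (F : 'I_n -> nat) (g : U -> 'I_n) :
  (forall p, x p \in I) -> (0 < \sum_p F p)%N ->
  (forall p, (\sum_p F p) * (\sum_u (g u == p)) = #|U| * F p)%N ->
  M [seq x (g u) | u : U] = mean_rep M F x.
Proof.
move=> xI F_gt0 gF.
have -> : [seq x (g u) | u : U] = [seq x p | p <- [seq g u | u : U]].
  by rewrite -map_comp.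
have -> : mean_rep M F x =
    M [seq x p | p <- flatten [seq nseq (F p) p | p : 'I_n]].
  rewrite /mean_rep map_flatten -map_comp; congr (M (flatten _)).
  by apply: eq_map => p /=; rewrite map_nseq.
have U_gt0 : (0 < #|U|)%N by apply/card_gt0P; exists u0.
apply: (mean_proportional xI F_gt0 U_gt0).
- by move/(congr1 size); rewrite size_image => U0; rewrite U0 in U_gt0.
- by move/(congr1 size); rewrite size_flatten_nseq => F0; rewrite F0 in F_gt0.
- by move=> p; rewrite count_image count_flatten_nseq gF.
Qed.

Lemma mean_rep_in (n : nat) (x : 'I_n -> R) (F : 'I_n -> nat) :
  (forall p, x p \in I) -> (0 < \sum_p F p)%N -> mean_rep M F x \in I.
Proof.
move=> xI F_gt0; apply: mean_in; split.
  by move/(congr1 size); rewrite size_flatten_nseq => F0; rewrite F0 in F_gt0.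
by move=> y /flattenP[_ /mapP[p _ ->] /nseqP[-> _]].
Qed.

(** Every [f u] is merely repeated [#|V|] times. This later discards the position inside a block,
    once the inner means depend on the block alone. *)
Lemma mean_fst (U V : finType) (u0 : U) (v0 : V) (f : U -> R) :
  (forall u, f u \in I) ->
  M [seq f w.1 | w : U * V] = M [seq f u | u : U].
Proof.
move=> fI; have V_gt0 : (0 < #|V|)%N by apply/card_gt0P; exists v0.
have dom (W : finType) (w0 : W) (h : W -> R) :
    (forall w, h w \in I) -> in_dom I [seq h w | w : W].
  move=> hI; apply: in_dom_map => // W0.
  by have := mem_enum W w0; rewrite W0.
rewrite -(repM V_gt0 (dom _ u0 _ fI)); apply: symM.
  by apply: (dom _ (u0, v0)) => w.
apply/permP => a; rewrite count_image count_flatten sumnE big_map big_map big_map.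
rewrite big_enum/= -(pair_big xpredT xpredT (fun u v => nat_of_bool (a (f u))))/=.
by apply: eq_bigr => u _; rewrite count_nseq sum_nat_const mulnC.
Qed.

End Mean.

(** * From conjugation to the block matrix inequality *)

(** Enumerating [U] and [V] reduces this to ordinals; it lets block matrices be indexed by pairs
    (block, position). *)
Lemma Ingham_Jessen_finType (R : realType) (I : interval R) (M N : seq R -> R)
    (U V : finType) (u0 : U) (v0 : V) (X : U -> V -> R) :
  Ingham_Jessen I M N -> (forall u v, X u v \in I) ->
  N [seq M [seq X u v | v : V] | u : U] <= M [seq N [seq X u v | u : U] | v : V].
Proof.
move=> IJ XI.
have U_gt0 : (0 < #|U|)%N by apply/card_gt0P; exists u0.
have V_gt0 : (0 < #|V|)%N by apply/card_gt0P; exists v0.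
have := IJ _ _ (fun i j => X (enum_val i) (enum_val j)) U_gt0 V_gt0
  (fun i j => XI _ _).
rewrite (image_enum_val u0 (fun u => M [seq X u (enum_val j) | j : 'I_#|V|])).
rewrite (image_enum_val v0 (fun v => N [seq X (enum_val i) v | i : 'I_#|U|])).
congr (N _ <= M _); apply: eq_map => w.
  by rewrite (image_enum_val v0 (X w)).
by rewrite (image_enum_val u0 (X^~ w)).
Qed.

(* The entries of the conjugating matrix, multiplied by a common denominator. *)
Lemma conjugated_counts (R : realType) (n k m : nat)
    (F : 'I_k -> 'I_n -> nat) (G : 'I_m -> 'I_n -> nat) :
  (0 < k)%N -> (0 < m)%N ->
  (forall i, 0 < \sum_p F i p)%N -> (forall j, 0 < \sum_p G j p)%N ->
  conjugated (fun i => distr R (F i)) (fun j => distr R (G j)) ->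
  exists (d : nat) (c : 'I_k -> 'I_m -> 'I_n -> nat), [/\ (0 < d)%N,
    forall i j, (\sum_p c i j p = d)%N,
    forall i p, ((\sum_p F i p) * \sum_j c i j p = m * d * F i p)%N
  & forall j p, ((\sum_p G j p) * \sum_i c i j p = k * d * G j p)%N].
Proof.
move=> k_gt0 m_gt0 F_gt0 G_gt0 [T [T_simplex FT GT]].
have nat_neq0 (S : numDomainType) (a : nat) : (0 < a)%N -> a%:R != 0 :> S.
  by rewrite pnatr_eq0 lt0n.
(* Unknowns are the triples (i, j, p). Equations: each [T i j] has total 1, then the sums over [j]
   and over [i], with the averaging factors [m] and [k] moved to the right-hand side [b]. *)
pose A (v : 'I_k * 'I_m * 'I_n)
    (e : 'I_k * 'I_m + ('I_k * 'I_n + 'I_m * 'I_n)) :=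
  match e with
  | inl ij => v.1 == ij
  | inr (inl (i, p)) => (v.1.1 == i) && (v.2 == p)
  | inr (inr (j, p)) => (v.1.2 == j) && (v.2 == p)
  end.
pose b (e : 'I_k * 'I_m + ('I_k * 'I_n + 'I_m * 'I_n)) : rat :=
  match e with
  | inl _ => 1
  | inr (inl (i, p)) => m%:R * ((F i p)%:R / (\sum_q F i q)%N%:R)
  | inr (inr (j, p)) => k%:R * ((G j p)%:R / (\sum_q G j q)%N%:R)
  end.
(* Stated for a general [S] since it serves both for the real entries of [T] and for the natural
   numbers [c]. *)
have sumA (S : nmodType) (h : 'I_k * 'I_m * 'I_n -> S) :
    [/\ forall i j, \sum_(v | A v (inl (i, j))) h v = \sum_p h (i, j, p),
        forall i p, \sum_(v | A v (inr (inl (i, p)))) h v = \sum_j h (i, j, p)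
      & forall j p, \sum_(v | A v (inr (inr (j, p)))) h v = \sum_i h (i, j, p)].
  split.
  - move=> i j; rewrite (reindex_onto (fun p => (i, j, p)) snd)/=.
      by apply: eq_bigl => p; rewrite !eqxx.
    by case=> ij p /= /eqP ->.
  - move=> i p; rewrite (reindex_onto (fun j => (i, j, p)) (fun v => v.1.2))/=.
      by apply: eq_bigl => j; rewrite !eqxx.
    by case=> [[i' j] p'] /= /andP[/eqP -> /eqP ->].
  - move=> j p; rewrite (reindex_onto (fun i => (i, j, p)) (fun v => v.1.1))/=.
      by apply: eq_bigl => i; rewrite !eqxx.
    by case=> [[i j'] p'] /= /andP[/eqP -> /eqP ->].
have [||d [c [d_gt0 cE]]] := @integral_nonneg_solution R _ _ A b
    (fun v => T v.1.1 v.1.2 0 v.2).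
- by move=> [[i j] p]; have [/(_ p)/andP[]] := T_simplex i j.
- have [s1 s2 s3] := sumA R (fun v => T v.1.1 v.1.2 0 v.2).
  case=> [[i j]|[[i p]|[j p]]].
  + by rewrite s1/= rmorph1; have [] := T_simplex i j.
  + rewrite s2/= !rmorphM/= fmorphV/= !ratr_nat.
    have /rowP/(_ p) := FT i; rewrite !mxE summxE => ->.
    by rewrite mulVKf ?nat_neq0.
  + rewrite s3/= !rmorphM/= fmorphV/= !ratr_nat.
    have /rowP/(_ p) := GT j; rewrite !mxE summxE => ->.
    by rewrite mulVKf ?nat_neq0.
have [s1 s2 s3] := sumA nat c.
exists d, (fun i j p => c (i, j, p)); split=> //.
- move=> i j; apply/eqP; rewrite -(eqr_nat rat).
  by rewrite -[X in X%:R]s1 cE mulr1.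
- move=> i p; apply/eqP; rewrite -(eqr_nat rat) !natrM.
  rewrite -[X in _ * X%:R]s2 cE/= mulrC -mulrA.
  by rewrite mulrCA -!mulrA mulVf ?nat_neq0// mulr1 mulrCA mulrA.
- move=> j p; apply/eqP; rewrite -(eqr_nat rat) !natrM.
  rewrite -[X in _ * X%:R]s3 cE/= mulrC -mulrA.
  by rewrite mulrCA -!mulrA mulVf ?nat_neq0// mulr1 mulrCA mulrA.
Qed.

Theorem theorem2p2 (R : realType) (I : interval R) (M N : seq R -> R)
  (meanM : is_mean I M) (meanN : is_mean I N)
  (symM : symmetric_mean I M) (symN : symmetric_mean I N)
  (repM : repetition_invariant I M) (repN : repetition_invariant I N)
  (IJ : Ingham_Jessen I M N)
  (k m n : nat) (k_gt0 : (0 < k)%N) (m_gt0 : (0 < m)%N) (n_gt0 : (0 < n)%N)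
  (F : 'I_k -> 'I_n -> nat) (G : 'I_m -> 'I_n -> nat)
  (F_neq0 : forall i, ~ (forall p, F i p = 0%N))
  (G_neq0 : forall j, ~ (forall p, G j p = 0%N))
  (conjFG : conjugated (fun i => distr R (F i)) (fun j => distr R (G j)))
  (x : 'I_n -> R) (xI : forall p, x p \in I) :
  N [seq mean_rep M (F i) x | i : 'I_k]
    <= M [seq mean_rep N (G j) x | j : 'I_m].
Proof.
have sum_gt0 (f : 'I_n -> nat) : ~ (forall p, f p = 0%N) -> (0 < \sum_p f p)%N.
  move=> f0; rewrite lt0n sum_nat_eq0; apply: contra_notN f0 => /forallP f0 p.
  exact/eqP/f0.
have {}F_neq0 i := sum_gt0 _ (F_neq0 i).
have {}G_neq0 j := sum_gt0 _ (G_neq0 j).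
have [d [c [d_gt0 c_sum cF cG]]] :=
  conjugated_counts k_gt0 m_gt0 F_neq0 G_neq0 conjFG.
(* Writing the denominator as a successor gives ['I_d.+1] its additive group, whose addition table
   is the Latin square. *)
case: d d_gt0 c_sum cF cG => // d _ c_sum cF cG.
pose g i j := sval (boolp.cid (fun_with_fiber_sizes (c_sum i j))).
have gE i j p : (\sum_a (g i j a == p) = c i j p)%N.
  by rewrite /g; case: boolp.cid.
have i0 := Ordinal k_gt0; have j0 := Ordinal m_gt0.
(* Each block (i, j) is a circulant Latin square, so that every row and every
   column of it lists the multiset encoded by [c i j]. *)
have := @Ingham_Jessen_finType R I M N ('I_k * 'I_d.+1)%type
  ('I_m * 'I_d.+1)%type (i0, ord0) (j0, ord0)
  (fun u v => x (g u.1 v.1 (u.2 + v.2))) IJ (fun _ _ => xI _).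
have rowE (u : 'I_k * 'I_d.+1) :
    M [seq x (g u.1 v.1 (u.2 + v.2)) | v : 'I_m * 'I_d.+1]
    = mean_rep M (F u.1) x.
  apply: (mean_image symM repM (j0, ord0)) => // p.
  (* A row has [m * d.+1] entries, so [cF] is exactly the required proportionality; in each block,
     translation by [u.2] permutes the positions. *)
  rewrite card_prod !card_ord -cF; congr (_ * _)%N.
  rewrite -(pair_big xpredT xpredT
    (fun j b => nat_of_bool (g u.1 j (u.2 + b) == p)))/=.
  by apply: eq_bigr => j _; rewrite -gE [RHS](reindex_inj (addrI u.2)).
have colE (v : 'I_m * 'I_d.+1) :
    N [seq x (g u.1 v.1 (u.2 + v.2)) | u : 'I_k * 'I_d.+1]
    = mean_rep N (G v.1) x.
  apply: (mean_image symN repN (i0, ord0)) => // p.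
  rewrite card_prod !card_ord -cG; congr (_ * _)%N.
  rewrite -(pair_big xpredT xpredT
    (fun i a => nat_of_bool (g i v.1 (a + v.2) == p)))/=.
  by apply: eq_bigr => i _; rewrite -gE [RHS](reindex_inj (addIr v.2)).
(* The row and column means now depend only on the block index, so [mean_fst] removes the
   [d.+1]-fold repetitions. *)
rewrite (eq_image (fun=> erefl) rowE) (eq_image (fun=> erefl) colE).
rewrite (mean_fst symN repN i0 ord0 (fun i => mean_rep_in meanM xI (F_neq0 i))).
by rewrite (mean_fst symM repM j0 ord0 (fun j => mean_rep_in meanN xI (G_neq0 j))).
Qed.
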